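(* Let $k$ be a fixed integer with $k\neq 0,\pm1$, let $0<p\le 1$, let $X$ be a quasi-Banach space with quasi-norm $\|\cdot\|_X$, let $Y$ be a $p$-Banach space with $p$-norm $\|\cdot\|_Y$, and let $M$ be the modulus of concavity of $\|\cdot\|_Y$. Let $j\in\{-1,1\}$ be fixed and let $\varphi:X\times X\to[0,\infty)$ be a function such that $$\lim_{n\to\infty}k^{2nj}\varphi\Big(\frac{x}{k^{nj}},\frac{y}{k^{nj}}\Big)=0$$ for all $x,y\in X$ and $$\tilde{\psi}_e(x):=\sum_{i=\frac{1+j}{2}}^{\infty}k^{2ipj}\,\varphi^p\Big(0,\frac{x}{k^{ij}}\Big)<\infty$$ for all $x\in X$. Suppose that an even function $f:X\to Y$ with $f(0)=0$ satisfies $$\|D_f(x,y)\|_Y\le\varphi(x,y)$$ for all $x,y\in X$, where $$D_f(x,y)=f(x+ky)+f(x-ky)-k^2f(x+y)-k^2f(x-y)-2(1-k^2)f(x).$$ Then the limit $$Q(x):=\lim_{n\to\infty}k^{2nj}f\Big(\frac{x}{k^{nj}}\Big)$$ exists for all $x\in X$, and $Q:X\to Y$ is a unique quadratic function satisfying $$\|f(x)-Q(x)\|_Y\le\frac{M}{2k^2}\big[\tilde{\psi}_e(x)\big]^{\frac1p}$$ for all $x\in X$.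
   Context: A quasi-norm on a real linear space $X$ is a real-valued function $\|\cdot\|$ such that (1) $\|x\|\ge0$ for all $x$, with $\|x\|=0$ if and only if $x=0$; (2) $\|\lambda x\|=|\lambda|\,\|x\|$ for all $\lambda\in\mathbb{R}$, $x\in X$; (3) there is a constant $M\ge1$ with $\|x+y\|\le M(\|x\|+\|y\|)$ for all $x,y\in X$. The smallest possible such $M$ is the modulus of concavity of $\|\cdot\|$. A quasi-Banach space is a complete quasi-normed space. A quasi-norm is a $p$-norm ($0<p\le1$) if $\|x+y\|^p\le\|x\|^p+\|y\|^p$ for all $x,y$; a quasi-Banach space whose quasi-norm is a $p$-norm is called a $p$-Banach space. A function $Q:X\to Y$ is quadratic if $Q(x+y)+Q(x-y)=2Q(x)+2Q(y)$ for all $x,y\in X$. Even means $f(-x)=f(x)$ for all $x\in X$. Here $\varphi^p(x,y)=(\varphi(x,y))^p$, and $k^{2ipj}$ means $(k^2)^{ipj}$. The limits and sums are over integers $n$ and $i$. *)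

(* Defs.v *)
From HB Require Import structures.
From mathcomp Require Import all_boot all_order all_algebra.
From mathcomp Require Import all_classical all_reals all_analysis.
Import Order.TTheory GRing.Theory Num.Theory.
Import numFieldNormedType.Exports.

Set Implicit Arguments.
Unset Strict Implicit.
Unset Printing Implicit Defensive.

Local Open Scope classical_set_scope.
Local Open Scope ring_scope.

Section QuasiNorm.
Context {R : realType} {V : lmodType R}.
Implicit Types (N : V -> R) (M p : R) (u : nat -> V).

Definition concavity_bound N M :=
  1 <= M /\ forall x y, N (x + y) <= M * (N x + N y).

Definition quasi_norm N :=
  [/\ forall x, 0 <= N x,
      forall x, N x = 0 <-> x = 0,
      forall (a : R) x, N (a *: x) = `|a| * N x
    & exists M, concavity_bound N M].

Definition modulus_of_concavity N M :=
  concavity_bound N M /\ forall M', concavity_bound N M' -> M <= M'.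

Definition quasi_cvg N u (l : V) := (fun n => N (u n - l)) @ \oo --> (0 : R).

Definition quasi_cauchy N u :=
  forall e : R, 0 < e -> \forall m & n \near \oo, N (u m - u n) < e.

Definition quasi_Banach N :=
  quasi_norm N /\ forall u, quasi_cauchy N u -> exists l, quasi_cvg N u l.

Definition p_norm p N :=
  quasi_norm N /\ forall x y, N (x + y) `^ p <= N x `^ p + N y `^ p.

Definition p_Banach p N := quasi_Banach N /\ p_norm p N.

End QuasiNorm.

Section Functional.
Context {R : realType} {X Y : lmodType R}.

Definition quadratic (Q : X -> Y) :=
  forall x y, Q (x + y) + Q (x - y) = 2 *: Q x + 2 *: Q y.

Definition even_function (f : X -> Y) := forall x, f (- x) = f x.

Definition D (k : int) (f : X -> Y) (x y : X) : Y :=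
  let c : R := k%:~R in
  f (x + c *: y) + f (x - c *: y) - c ^+ 2 *: f (x + y) - c ^+ 2 *: f (x - y)
    - (2 * (1 - c ^+ 2)) *: f x.

(* The lower index is (1 + j) / 2, that is 0 for j = -1 and 1 for j = 1; the
   terms are nonnegative when phi is, so the sum always exists in \bar R. *)
Definition psi_e (p : R) (k j : int) (phi : X -> X -> R) (x : X) : \bar R :=
  let term (i : nat) : R := (k%:~R ^+ 2) `^ (i%:R * p * j%:~R)
      * phi 0 ((k%:~R ^ (i%:Z * j))^-1 *: x) `^ p in
  (\sum_((`|(1 + j)%R| %/ 2)%N <= i <oo) (term i)%:E)%E.

End Functional.

(* Main.v *)
Require Import Defs.
From HB Require Import structures.
From mathcomp Require Import all_boot all_order all_algebra.
From mathcomp Require Import all_classical all_reals all_analysis.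
From mathcomp Require Import ring lra.
Import Order.TTheory GRing.Theory Num.Theory.
Import numFieldNormedType.Exports.

Set Implicit Arguments.
Unset Strict Implicit.
Unset Printing Implicit Defensive.

Local Open Scope classical_set_scope.
Local Open Scope ring_scope.

(** The argument is the direct (Hyers) method.  Put b = k ^ j, so that the
    approximants of the statement are the rescalings
    f_n(x) = b^(2n) f(b^(-n) x).

    For even f with f 0 = 0 one has D_f(0, y) = 2 (f (k y) - k^2 f y) ([D0l]);
    the control on D_f at (0, y) therefore bounds
    b^2 f(b^-1 x) - f x ([D_step]), and rescaling that bound shows that
    |f_(n+1)(x) - f_n(x)|^p is at most (1/(2k^2))^p times the n-th term of the
    series psi_e(x) ([rescale_step]).  The p-th power of a p-norm is
    subadditive, so the increments telescope: f_n(x) is a Cauchy sequence and its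
    limit Q(x) is at distance at most psi_e(x)^(1/p) / (2k^2) from f(x);
    the stated bound follows as M >= 1.

    The decay of phi gives D_Q = 0.  For an even Q vanishing at 0 this forces
    Q to be quadratic ([D0_quadratic]): the defect
    h(x, y) = Q(x + y) + Q(x - y) - 2 Q(x) - 2 Q(y) is symmetric and
    homogeneous of degree 2 under y |-> k y, hence of degree 4 under
    simultaneous scaling by k; but Q(k x) = k^2 Q(x) makes it of degree 2
    there, and k^4 <> k^2.

    For uniqueness, a quadratic Q' satisfies b^(2n) Q'(b^(-n) x) = Q'(x), so
    f_n - Q' is the rescaling of f - Q'; rescaling psi_e(x) yields the tail of
    its own series, which tends to 0.  Thus every admissible Q' is the limit of
    the f_n ([rescale_cvg_homogeneous]). *)

(** * Real powers of null sequences, and series of nonnegative terms *)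

Section RealSequences.
Context {R : realType}.
Implicit Types (v u : nat -> R) (q : R).

Lemma cvg0_powR v q : 0 < q -> (forall n, 0 <= v n) ->
  v @ \oo --> (0 : R) -> (fun n => v n `^ q) @ \oo --> (0 : R).
Proof.
move=> q0 v0 vc; apply/cvgr0Pnorm_lt => e e0.
have e'0 : 0 < e `^ q^-1 by rewrite powR_gt0.
near=> n.
rewrite ger0_norm ?powR_ge0//.
have -> : e = (e `^ q^-1) `^ q by rewrite -powRrM mulVf ?gt_eqF// powRr1 ?ltW.
apply: gt0_ltr_powR; rewrite ?nnegrE ?v0 ?(ltW e'0)//.
rewrite -[v n]ger0_norm ?v0//.
by near: n; exact: cvgr0_norm_lt.
Unshelve. all: by end_near. Qed.

Lemma cvg0_powRK v q : 0 < q -> (forall n, 0 <= v n) ->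
  (fun n => v n `^ q) @ \oo --> (0 : R) -> v @ \oo --> (0 : R).
Proof.
move=> q0 v0 vc.
have -> : v = fun n => (v n `^ q) `^ q^-1.
  by apply/funext => n; rewrite -powRrM mulfV ?gt_eqF// powRr1.
by apply: cvg0_powR => // [|n]; rewrite ?invr_gt0// powR_ge0.
Qed.

(** Moves from the extended-real sum that defines psi_e to real partial sums,
    where limits can be subtracted. *)
Lemma nneseries_cvg_fine v : (forall n, 0 <= v n) ->
  (\sum_(0 <= n <oo) (v n)%:E < +oo)%E ->
  series v @ \oo --> fine (\sum_(0 <= n <oo) (v n)%:E)%E.
Proof.
move=> v0 voo.
have c := @is_cvg_nneseries R (EFin \o v) xpredT 0%N
  (fun n _ _ => v0 n : (0 <= (v n)%:E)%E).
have fn : (\sum_(0 <= n <oo) (v n)%:E)%E \is a fin_num.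
  by rewrite ge0_fin_numE//; apply: nneseries_ge0 => n _ _; rewrite lee_fin.
have -> : series v = fine \o (fun n => \sum_(0 <= i < n) (v i)%:E)%E.
  by apply/funext => n; rewrite /= sumEFin.
by apply: fine_cvg; rewrite fineK.
Qed.

Lemma series_le_limit v l n : (forall n, 0 <= v n) ->
  series v @ \oo --> l -> series v n <= l.
Proof.
move=> v0 vl; rewrite -(cvg_lim _ vl)//.
apply: nondecreasing_cvgn_le; last by apply/cvg_ex; exists l.
by apply: nondecreasing_series => i _ _; exact: v0.
Qed.

Lemma series_addn v m n :
  series v (m + n)%N = series v m + series (fun i => v (m + i)%N) n.
Proof.
rewrite /series /= (@big_cat_nat _ _ _ m)//= ?leq_addr//; congr (_ + _).
rewrite -{1}[m]add0n big_addn addKn.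
by apply: eq_bigr => i _; rewrite addnC.
Qed.

End RealSequences.

(** * Convergence for a quasi-norm *)

Section QuasiNormed.
Context {R : realType} {V : lmodType R}.
Variable N : V -> R.
Hypothesis qN : quasi_norm N.
Implicit Types (u : nat -> V) (x y l : V).

Lemma quasi_norm_ge0 x : 0 <= N x. Proof. by case: qN. Qed.
Lemma quasi_norm_eq0 x : N x = 0 -> x = 0. Proof. by case: qN => _ H _ _ /H. Qed.
Lemma quasi_normZ (a : R) x : N (a *: x) = `|a| * N x. Proof. by case: qN. Qed.
Lemma quasi_norm0 : N 0 = 0. Proof. by case: qN => _ H _ _; apply/H. Qed.
Lemma quasi_normN x : N (- x) = N x.
Proof. by rewrite -scaleN1r quasi_normZ normrN1 mul1r. Qed.
Lemma quasi_normBC x y : N (x - y) = N (y - x).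
Proof. by rewrite -opprB quasi_normN. Qed.

Lemma quasi_cvgD u v x y :
  quasi_cvg N u x -> quasi_cvg N v y -> quasi_cvg N (fun n => u n + v n) (x + y).
Proof.
move=> ux vy; have [_ _ _ [M [_ HM]]] := qN.
apply: (@squeeze_cvgr _ _ _ _ (cst 0) (fun n => M * (N (u n - x) + N (v n - y)))).
- apply: nearW => n /=; rewrite quasi_norm_ge0/=.
  by rewrite opprD addrACA HM.
- exact: cvg_cst.
- rewrite -(mulr0 M) -(addr0 (0 : R)).
  by apply: cvgM; [exact: cvg_cst|exact: cvgD].
Qed.

Lemma quasi_cvgZ (a : R) u x :
  quasi_cvg N u x -> quasi_cvg N (fun n => a *: u n) (a *: x).
Proof.
move=> ux; rewrite /quasi_cvg.
under eq_fun do rewrite -scalerBr quasi_normZ.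
by rewrite -(mulr0 `|a|); apply: cvgM => //; exact: cvg_cst.
Qed.

Lemma quasi_cvgB u v x y :
  quasi_cvg N u x -> quasi_cvg N v y -> quasi_cvg N (fun n => u n - v n) (x - y).
Proof.
move=> ux /(quasi_cvgZ (-1)) vy; have := quasi_cvgD ux vy.
by rewrite scaleN1r; under eq_fun do rewrite scaleN1r.
Qed.

Lemma quasi_cvg_cst x : quasi_cvg N (fun=> x) x.
Proof. by rewrite /quasi_cvg; under eq_fun do rewrite subrr quasi_norm0; exact: cvg_cst. Qed.

Lemma quasi_cvg_unique u x y : quasi_cvg N u x -> quasi_cvg N u y -> x = y.
Proof.
move=> ux uy; have := quasi_cvgB ux uy; rewrite /quasi_cvg.
under eq_fun do rewrite subrr add0r quasi_normN.
move=> c; apply/eqP; rewrite -subr_eq0; apply/eqP/quasi_norm_eq0.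
by apply: (cvg_unique _ (cvg_cst _) c).
Qed.

End QuasiNormed.

(** * Telescoping for a p-norm *)

Section PNormed.
Context {R : realType} {V : lmodType R}.
Variables (N : V -> R) (p : R).
Hypotheses (p0 : 0 < p) (pN : p_norm p N).
Implicit Types (u : nat -> V) (w : nat -> R).

(** Lets convergence be tested on the p-th power of the norm, which unlike the
    norm itself obeys the triangle inequality with constant 1. *)
Lemma quasi_cvg_powR u l :
  quasi_cvg N u l <-> (fun n => N (u n - l) `^ p) @ \oo --> (0 : R).
Proof.
split; [apply: cvg0_powR|apply: cvg0_powRK] => // n;
  exact: (quasi_norm_ge0 pN.1).
Qed.

Lemma p_norm_triangle x y z : N (x - z) `^ p <= N (x - y) `^ p + N (y - z) `^ p.
Proof. by have [_] := pN => /(_ (x - y) (y - z)); rewrite addrA subrK. Qed.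

(** A constant M > 1 in the triangle inequality would be raised to the number
    of summands; passing to p-th powers keeps it equal to 1. *)
Lemma p_norm_telescope u w m n :
  (forall i, N (u i.+1 - u i) `^ p <= w i) ->
  N (u (m + n)%N - u m) `^ p <= series w (m + n)%N - series w m.
Proof.
move=> uw; elim: n => [|n IH].
  by rewrite addn0 !subrr (quasi_norm0 pN.1) powR0 ?gt_eqF.
apply: le_trans (p_norm_triangle _ (u (m + n)%N) _) _.
rewrite addnS [series w _.+1]seriesSr addrAC addrC.
by apply: lerD.
Qed.

Lemma p_norm_cauchy u w (l : R) :
  (forall i, N (u i.+1 - u i) `^ p <= w i) ->
  series w @ \oo --> l -> quasi_cauchy N u.
Proof.
move=> uw wl e e0.
(* Norms below e amount to p-th powers below e `^ p, shared between two tails. *)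
have e'0 : 0 < e `^ p / 2 by rewrite divr_gt0 ?powR_gt0.
have [K _ HK] : \forall n \near \oo, `|l - series w n| < e `^ p / 2.
  by move/cvgrPdist_lt : wl; exact.
have main m n : (K <= m)%N -> N (u (m + n)%N - u m) < e.
  move=> Km; have N0 := quasi_norm_ge0 pN.1.
  rewrite ltNge; apply/negP => /(ge0_ler_powR (ltW p0)).
  rewrite !nnegrE N0 (ltW e0) => /(_ isT isT); apply/negP; rewrite -ltNge.
  apply: le_lt_trans (p_norm_telescope _ _ uw) _.
  have := HK _ Km; have := HK (m + n)%N (leq_trans Km (leq_addr _ _)).
  rewrite !ltr_norml => /andP[? ?] /andP[? ?]; lra.
exists ([set n | (K <= n)%N], [set n | (K <= n)%N]) => /=.
  by split; exists K.
move=> [m n] /= [Km Kn].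
have [mn|/ltnW nm] := leqP m n.
  by rewrite (quasi_normBC pN.1) -(subnKC mn) main.
by rewrite -(subnKC nm) main.
Qed.

(** A quasi-norm need not be continuous, but its p-th power is within
    N (u n - x) `^ p of its limit, so the telescoped bound survives n -> oo. *)
Lemma p_norm_limit_bound u w x (l : R) :
  (forall i, 0 <= w i) ->
  (forall i, N (u i.+1 - u i) `^ p <= w i) ->
  series w @ \oo --> l -> quasi_cvg N u x -> N (u 0%N - x) `^ p <= l.
Proof.
move=> w0 uw wl /quasi_cvg_powR ux.
have c : (fun n => l + N (u n - x) `^ p) @ \oo --> l.
  by rewrite -{2}[l]addr0; apply: cvgD => //; exact: cvg_cst.
apply: (cvgr_to_ge c); apply: nearW => n.
apply: le_trans (p_norm_triangle _ (u n) _) _.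
rewrite lerD2r (quasi_normBC pN.1).
apply: le_trans (p_norm_telescope 0 n uw) _.
by rewrite add0n /series /= (big_geq (leqnn 0)) subr0; exact: series_le_limit.
Qed.

End PNormed.

(** * Quadratic functions and the operator D *)

Section FunctionalEquations.
Context {R : realType} {X Y : lmodType R}.
Implicit Types (Q f : X -> Y) (k : int) (b : R).

Lemma scaler2_inj (V : lmodType R) (u v : V) : 2 *: u = 2 *: v -> u = v.
Proof. by apply: scalerI; rewrite pnatr_eq0. Qed.

Lemma D0l k f y : even_function f -> f 0 = 0 ->
  D k f 0 y = 2 *: (f (k%:~R *: y) - k%:~R ^+ 2 *: f y).
Proof.
move=> ev f0.
by rewrite /D !add0r !ev f0 scaler0 subr0 -mulr2n -addrA -mulr2n mulNrn -mulrnBl scaler_nat.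
Qed.

(** The defect h of the quadratic equation satisfies h(x, k y) = k^2 h(x, y)
    because D_Q = 0, and it is symmetric because Q is even, so
    h(k x, k y) = k^4 h(x, y).  The homogeneity of Q gives k^2 instead, and
    k^2 (k^2 - 1) <> 0 kills h. *)
Lemma D0_quadratic k Q : k != 0 -> k != 1 -> k != -1 ->
  even_function Q -> Q 0 = 0 -> (forall x y, D k Q x y = 0) -> quadratic Q.
Proof.
move=> k0 k1 kN1 ev Q0 DQ.
set c : R := k%:~R.
have Qc y : Q (c *: y) = c ^+ 2 *: Q y.
  have := DQ 0 y; rewrite D0l// => /eqP; rewrite scaler_eq0 pnatr_eq0 /=.
  by rewrite subr_eq0 => /eqP.
pose h x y := Q (x + y) + Q (x - y) - (2 *: Q x + 2 *: Q y).
have hC x y : h x y = h y x.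
  by rewrite /h [y + x]addrC -[in Q (y - x)]opprB ev [2 *: Q y + _]addrC.
have hr x y : h x (c *: y) = c ^+ 2 *: h x y.
  rewrite /h; have -> : Q (x + c *: y) + Q (x - c *: y) =
      2 *: Q x + c ^+ 2 *: (Q (x + y) + Q (x - y) - 2 *: Q x).
    have := DQ x y; rewrite /D -/c => /eqP; rewrite subr_eq0 => /eqP.
    move=> /(canRL (subrK _)) /(canRL (subrK _)) ->.
    rewrite mulrBr mulr1 scalerBl scalerBr scalerDr scalerA [2 * _]mulrC.
    by rewrite -!addrA; congr (_ + _); rewrite addrC -addrA [RHS]addrCA addrC -addrA.
  rewrite Qc opprD addrACA subrr add0r scalerA [2 * _]mulrC -[(_ * 2) *: _]scalerA.
  by rewrite -scalerBr opprD addrA.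
have hl x y : h (c *: x) y = c ^+ 2 *: h x y by rewrite hC hr hC.
have hcc x y : h (c *: x) (c *: y) = c ^+ 2 *: h x y.
  by rewrite /h -scalerDr -scalerBr !Qc !scalerBr !scalerDr !scalerA ![_ * 2]mulrC.
move=> x y; apply/eqP; rewrite -subr_eq0 -/(h x y).
have : (c ^+ 2 * (c ^+ 2 - 1)) *: h x y == 0.
  by rewrite mulrBr mulr1 scalerBl -[(c ^+ 2 * _) *: _]scalerA -hl -hr hcc hl subrr.
rewrite scaler_eq0 mulf_eq0 expf_eq0 /= intr_eq0 (negbTE k0)/=.
rewrite subr_eq0 sqrf_eq1 -[-1]/((-1)%:~R) -[1]/(1%:~R) !eqr_int.
by rewrite (negbTE k1) (negbTE kN1).
Qed.

Lemma quadratic0 Q : quadratic Q -> Q 0 = 0.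
Proof.
move=> qQ; have := qQ 0 0; rewrite addr0 subr0 -mulr2n -scaler_nat -scalerDr.
by move=> /scaler2_inj /esym /eqP; rewrite -subr_eq0 addrK => /eqP.
Qed.

Lemma quadratic_even Q : quadratic Q -> even_function Q.
Proof.
move=> qQ x; have := qQ 0 x; rewrite !add0r quadratic0// scaler0 add0r.
by rewrite scaler_nat mulr2n => /addrI.
Qed.

Lemma quadraticZ_nat Q (n : nat) x : quadratic Q ->
  Q (n%:R *: x) = n%:R ^+ 2 *: Q x.
Proof.
move=> qQ; elim/ltn_ind: n => -[|[|n]] IH.
- by rewrite !scale0r quadratic0// expr0n scale0r.
- by rewrite expr1n !scale1r.
have := qQ (n.+1%:R *: x) x.
have -> : n.+1%:R *: x + x = n.+2%:R *: x by rewrite -[n.+2%:R]natr1 scalerDl scale1r.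
have -> : n.+1%:R *: x - x = n%:R *: x by rewrite -natr1 scalerDl scale1r addrK.
rewrite (IH n.+1)// (IH n)// !scalerA -scalerDl => /(canRL (addrK _)) ->.
by rewrite -scalerBl; congr (_ *: _); rewrite -!natr1; ring.
Qed.

Lemma quadraticZ_int Q k x : quadratic Q ->
  Q (k%:~R *: x) = k%:~R ^+ 2 *: Q x.
Proof.
move=> qQ; case: k => n; first exact: quadraticZ_nat.
by rewrite NegzE mulrNz scaleNr quadratic_even// sqrrN quadraticZ_nat.
Qed.

(** The approximants of the direct method; functions homogeneous of degree 2
    under b are its fixed points ([rescale_hom]). *)
Definition rescale b f (n : nat) (x : X) : Y :=
  (b ^+ n) ^+ 2 *: f ((b ^+ n)^-1 *: x).

Lemma D_rescale k b f n x y :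
  D k (rescale b f n) x y
    = (b ^+ n) ^+ 2 *: D k f ((b ^+ n)^-1 *: x) ((b ^+ n)^-1 *: y).
Proof.
rewrite /D /rescale !scalerDr !scalerN !scalerA.
by rewrite ![_ * (b ^+ n) ^+ 2]mulrC [_ * (b ^+ n)^-1]mulrC.
Qed.

Lemma rescale_hom b f n x : b != 0 ->
  (forall x, f (b *: x) = b ^+ 2 *: f x) -> rescale b f n x = f x.
Proof.
move=> b0 fb.
have fbn m z : f (b ^+ m *: z) = (b ^+ m) ^+ 2 *: f z.
  elim: m z => [|m IH] z; first by rewrite expr0 expr1n !scale1r.
  by rewrite exprS -scalerA fb IH scalerA -exprMn.
by rewrite /rescale -fbn scalerA divff ?expf_neq0// scale1r.
Qed.

Lemma rescaleS b f n x :
  rescale b f n.+1 x - rescale b f n x =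
   (b ^+ n) ^+ 2 *: (b ^+ 2 *: f (b^-1 *: ((b ^+ n)^-1 *: x))
                      - f ((b ^+ n)^-1 *: x)).
Proof.
by rewrite /rescale scalerBr !scalerA [b ^+ n.+1]exprS exprMn invfM [b ^+ 2 * _]mulrC.
Qed.

End FunctionalEquations.

(** * The rescaling iteration *)

Section Iteration.
Context {R : realType} {X Y : lmodType R}.
Variables (N : Y -> R) (p b C : R) (s : nat) (phi : X -> X -> R) (f : X -> Y).

(** The terms of psi_e with the exponent j absorbed in b = k ^ j and the
    sum reindexed from 0, the former lower index becoming the shift s. *)
Definition control (x : X) (i : nat) : R :=
  ((b ^+ (s + i)) ^+ 2 * phi 0 ((b ^+ (s + i))^-1 *: x)) `^ p.

Hypotheses (p0 : 0 < p) (BN : p_Banach p N) (b0 : b != 0) (C0 : 0 <= C).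
Hypothesis phi0 : forall x y, 0 <= phi x y.
Hypothesis step : forall x, N (b ^+ 2 *: f (b^-1 *: x) - f x)
  <= C * ((b ^+ s) ^+ 2 * phi 0 ((b ^+ s)^-1 *: x)).
Variable F : X -> R.
Hypothesis controlF : forall x, series (control x) @ \oo --> F x.

Let pN : p_norm p N := BN.2.
Let qN : quasi_norm N := pN.1.

Let weight_ge0 n x : 0 <= (b ^+ n) ^+ 2 * phi 0 x.
Proof. exact: mulr_ge0 (sqr_ge0 _) (phi0 _ _). Qed.

Lemma control_ge0 x i : 0 <= control x i. Proof. exact: powR_ge0. Qed.

Let F_ge0 x : 0 <= F x.
Proof.
have := series_le_limit 0 (control_ge0 x) (@controlF x).
by rewrite /series /= big_geq.
Qed.

(** Rescaling the argument shifts the control sequence, since both are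
    powers of the same dilation by b. *)
Lemma control_shift x n i :
  control x (n + i)%N = ((b ^+ n) ^+ 2) `^ p * control ((b ^+ n)^-1 *: x) i.
Proof.
rewrite /control -powRM ?sqr_ge0 ?weight_ge0//.
by rewrite addnCA exprD exprMn mulrA scalerA invfM [(b ^+ n)^-1 * _]mulrC.
Qed.

(** Summing [control_shift]: the rescaled sum F is the n-th tail of its
    series.  This is what makes the error of any solution vanish under
    rescaling. *)
Lemma control_limit_rescale x n :
  ((b ^+ n) ^+ 2) `^ p * F ((b ^+ n)^-1 *: x) = F x - series (control x) n.
Proof.
apply: (@cvg_unique _ _ (series (fun i => control x (n + i)%N) @ \oo)) => //.
- have -> : series (fun i => control x (n + i)%N) =
    (fun m => ((b ^+ n) ^+ 2) `^ p * series (control ((b ^+ n)^-1 *: x)) m).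
    apply/funext => m; rewrite /series /= mulr_sumr.
    by apply: eq_bigr => i _; exact: control_shift.
  by apply: cvgM; [exact: cvg_cst|exact: (@controlF _)].
- have -> : series (fun i => control x (n + i)%N) =
    (fun m => series (control x) (m + n)%N - series (control x) n).
    by apply/funext => m; rewrite addnC series_addn addrAC subrr add0r.
  apply: cvgB; last exact: cvg_cst.
  by have := @controlF x; rewrite -(cvg_shiftn n).
Qed.

Lemma rescale_step x n :
  N (rescale b f n.+1 x - rescale b f n x) `^ p <= C `^ p * control x n.
Proof.
rewrite rescaleS (quasi_normZ qN) ger0_norm ?sqr_ge0//.
have P0 := sqr_ge0 (b ^+ n).
have N0 := quasi_norm_ge0 qN.
set z := (b ^+ n)^-1 *: x.
rewrite powRM// -[n in control x n]addn0 control_shift mulrCA.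
rewrite ler_wpM2l ?powR_ge0// /control addn0 -powRM ?weight_ge0//.
by rewrite ge0_ler_powR ?nnegrE ?(ltW p0)// mulr_ge0 ?weight_ge0.
Qed.

Let cvg_w x : series (fun n => C `^ p * control x n) @ \oo --> C `^ p * F x.
Proof.
have -> : series (fun n => C `^ p * control x n) =
    (fun m => C `^ p * series (control x) m).
  by apply/funext => m; rewrite /series /= mulr_sumr.
by apply: cvgM; [exact: cvg_cst|exact: (@controlF _)].
Qed.

Lemma rescale_cvg x : exists l, quasi_cvg N (fun n => rescale b f n x) l.
Proof.
apply: BN.1.2; apply: (p_norm_cauchy p0 pN (rescale_step x)); exact: cvg_w.
Qed.

Lemma rescale_limit_bound x l :
  quasi_cvg N (fun n => rescale b f n x) l -> N (f x - l) <= C * F x `^ p^-1.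
Proof.
move=> xl; have N0 := quasi_norm_ge0 qN.
have w0 i : 0 <= C `^ p * control x i by rewrite mulr_ge0 ?powR_ge0.
have := p_norm_limit_bound p0 pN w0 (rescale_step x) (@cvg_w x) xl.
rewrite /rescale expr0 expr1n invr1 !scale1r => le.
have F0 := F_ge0 x.
have ip0 : 0 <= p^-1 by rewrite invr_ge0 ltW.
have := ge0_ler_powR ip0 _ _ le; rewrite !nnegrE powR_ge0 mulr_ge0 ?powR_ge0//.
move=> /(_ isT isT).
by rewrite powRM ?powR_ge0// -!powRrM mulfV ?gt_eqF// !powRr1.
Qed.

(** A degree-2 homogeneous Q is fixed by rescaling, so f_n - Q is the
    rescaling of f - Q and its p-th power is dominated by a tail of the
    control series. *)
Lemma rescale_cvg_homogeneous (A : R) (Q : X -> Y) x : 0 <= A ->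
  (forall x, Q (b *: x) = b ^+ 2 *: Q x) ->
  (forall x, N (f x - Q x) <= A * F x `^ p^-1) ->
  quasi_cvg N (fun n => rescale b f n x) (Q x).
Proof.
move=> A0 Qb fQ; apply/(quasi_cvg_powR p0 pN).
apply: (@squeeze_cvgr _ _ _ _ (cst 0)
  (fun n => A `^ p * (F x - series (control x) n))).
- apply: nearW => n /=; rewrite powR_ge0/= -control_limit_rescale.
  rewrite -(rescale_hom n x b0 Qb) /rescale -scalerBr (quasi_normZ qN).
  have P0 := sqr_ge0 (b ^+ n); have N0 := quasi_norm_ge0 qN.
  rewrite ger0_norm// powRM// mulrCA ler_wpM2l ?powR_ge0//.
  set z := (b ^+ n)^-1 *: x.
  have := ge0_ler_powR (ltW p0) _ _ (fQ z); rewrite !nnegrE N0 mulr_ge0 ?powR_ge0//.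
  move=> /(_ isT isT).
  by rewrite powRM ?powR_ge0// -powRrM mulVf ?gt_eqF// powRr1.
- exact: cvg_cst.
- rewrite -(mulr0 (A `^ p)) -(subrr (F x)).
  apply: cvgM; first exact: cvg_cst.
  by apply: cvgB; [exact: cvg_cst|exact: (@controlF _)].
Qed.

End Iteration.

(** * From the control on D to the iteration *)

Section Specialization.
Context {R : realType} {X Y : lmodType R}.
Implicit Types (k j : int) (p : R) (phi : X -> X -> R) (f : X -> Y).

Lemma psi_e_control p k j phi x : (forall x y, 0 <= phi x y) ->
  psi_e p k j phi x =
  (\sum_(0 <= i <oo) (control p (k%:~R ^ j) (`|(1 + j)%R| %/ 2)%N phi x i)%:E)%E.
Proof.
move=> phi0; rewrite /psi_e -nneseries_addn; last first.
  by move=> i; rewrite lee_fin mulr_ge0 ?powR_ge0.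
apply: eq_eseriesr => i _; congr EFin.
rewrite addnC /control; set n := (_ + i)%N.
have -> : (k%:~R : R) ^ (n%:Z * j) = (k%:~R ^ j) ^+ n.
  by rewrite mulrC -exprz_exp.
rewrite powRM ?sqr_ge0//; congr (_ * _).
rewrite -mulrA [p * _]mulrC mulrA powRrM; congr (_ `^ _).
have -> : n%:R * j%:~R = (n%:Z * j)%:~R :> R by rewrite intrM.
rewrite powR_intmul ?sqr_ge0// -[(k%:~R : R) ^+ 2]/(k%:~R ^ 2%:Z).
rewrite -[RHS]/(((k%:~R ^ j) ^ n%:Z) ^ 2%:Z) !exprz_exp.
by congr (_ ^ _); ring.
Qed.

(** For j = 1 the inequality at (0, x / k) is used as it stands; for j = -1
    the one at (0, x) is divided by k^2.  The lower index of psi_e, 1 or 0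
    accordingly, is what produces the common constant 1 / (2 k^2). *)
Lemma D_step (N : Y -> R) k j f phi x (b := (k%:~R : R) ^ j)
    (s := (`|(1 + j)%R| %/ 2)%N) :
  k != 0 -> j = -1 \/ j = 1 -> even_function f -> f 0 = 0 ->
  quasi_norm N -> (forall x y, N (D k f x y) <= phi x y) ->
  N (b ^+ 2 *: f (b^-1 *: x) - f x) <=
  (2 * k%:~R ^+ 2)^-1 * ((b ^+ s) ^+ 2 * phi 0 ((b ^+ s)^-1 *: x)).
Proof.
move=> k0 hj ev f0 qN Dphi.
have c0 : (k%:~R : R) != 0 by rewrite intr_eq0.
set c : R := k%:~R in b c0 *.
have base y : N (f (c *: y) - c ^+ 2 *: f y) <= 2^-1 * phi 0 y.
  have := Dphi 0 y; rewrite D0l// (quasi_normZ qN) ger0_norm// -/c => h.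
  by rewrite -ler_pdivrMl ?invr_gt0// invrK.
case: hj => jE; rewrite /s /b jE /=.
- rewrite expr0 expr1n invr1 scale1r mul1r exprN1 invrK.
  have -> : c^-1 ^+ 2 *: f (c *: x) - f x =
     c^-1 ^+ 2 *: (f (c *: x) - c ^+ 2 *: f x).
    by rewrite scalerBr scalerA -exprMn mulVf// expr1n scale1r.
  rewrite (quasi_normZ qN) ger0_norm ?sqr_ge0// invfM mulrC -exprVn.
  rewrite [2^-1 * _]mulrC -mulrA [leLHS]mulrC.
  by rewrite ler_wpM2l ?sqr_ge0.
- rewrite !expr1z -[(_ %/ _)%N]/1%N expr1 (quasi_normBC qN).
  have := base (c^-1 *: x); rewrite scalerA mulfV// scale1r => /le_trans; apply.
  rewrite le_eqVlt; apply/orP; left; apply/eqP; field.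
  exact: c0.
Qed.

End Specialization.

Theorem theorem3p2 (R : realType) (k : int) (p : R) (X Y : lmodType R)
    (NX : X -> R) (NY : Y -> R) (M : R) (j : int)
    (phi : X -> X -> R) (f : X -> Y) :
  k != 0 -> k != 1 -> k != -1 ->
  0 < p -> p <= 1 ->
  quasi_Banach NX ->
  p_Banach p NY ->
  modulus_of_concavity NY M ->
  j = -1 \/ j = 1 ->
  (forall x y, 0 <= phi x y) ->
  (forall x y,
     (fun n : nat => (k%:~R : R) ^ (2 * n%:Z * j) *
        phi ((k%:~R ^ (n%:Z * j))^-1 *: x) ((k%:~R ^ (n%:Z * j))^-1 *: y))
       @ \oo --> (0 : R)) ->
  (forall x, (psi_e p k j phi x < +oo)%E) ->
  even_function f ->
  f 0 = 0 ->
  (forall x y, NY (D k f x y) <= phi x y) ->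
  exists Q : X -> Y,
    (forall x, quasi_cvg NY
       (fun n : nat => (k%:~R : R) ^ (2 * n%:Z * j) *:
                         f ((k%:~R ^ (n%:Z * j))^-1 *: x))
       (Q x)) /\
    unique (fun Q' : X -> Y =>
      quadratic Q' /\
      forall x, NY (f x - Q' x) <=
        M / (2 * k%:~R ^+ 2) * fine (psi_e p k j phi x) `^ p^-1) Q.
Proof.
move=> k0 k1 kN1 p0 p1 _ BN [[M1 _] _] hj phi0 phi_lim psi_fin ev f0 Dphi.
have qN : quasi_norm NY := BN.2.1.
have c0 : (k%:~R : R) != 0 by rewrite intr_eq0.
set b : R := k%:~R ^ j; set s := (`|(1 + j)%R| %/ 2)%N.
have b0 : b != 0 by rewrite /b expfz_neq0.
set C : R := (2 * k%:~R ^+ 2)^-1.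
have C0 : 0 <= C by rewrite invr_ge0 mulr_ge0 ?sqr_ge0.
have step x := D_step x k0 hj ev f0 qN Dphi.
set F := fun x => fine (psi_e p k j phi x).
have controlF x : series (control p b s phi x) @ \oo --> F x.
  rewrite /F psi_e_control//; apply: nneseries_cvg_fine.
    by move=> i; exact: control_ge0.
  by rewrite -psi_e_control.
have bn n : (k%:~R : R) ^ (n%:Z * j) = b ^+ n by rewrite mulrC -exprz_exp.
have bn2 n : (k%:~R : R) ^ (2 * n%:Z * j) = (b ^+ n) ^+ 2.
  by rewrite -mulrA mulrC -exprz_exp bn.
have := rescale_cvg p0 BN C0 phi0 step controlF.
move=> /choice[Q hQ].
have Q0 : Q 0 = 0.
  apply: (quasi_cvg_unique qN (hQ 0)).
  rewrite /rescale; under eq_fun do rewrite scaler0 f0 scaler0.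
  exact: quasi_cvg_cst.
have evQ : even_function Q.
  move=> x; apply: (quasi_cvg_unique qN (hQ (- x))).
  by rewrite /rescale; under eq_fun do rewrite scalerN ev; exact: hQ.
have DQ x y : D k Q x y = 0.
  apply: (@quasi_cvg_unique _ _ _ qN (fun n => D k (rescale b f n) x y)).
    by rewrite /D; do ![apply: quasi_cvgB|apply: quasi_cvgD|apply: quasi_cvgZ].
  rewrite /quasi_cvg; under eq_fun do rewrite subr0 D_rescale (quasi_normZ qN).
  apply: (@squeeze_cvgr _ _ _ _ (cst 0) _ _ _ _ _ (phi_lim x y)).
    apply: nearW => n /=; rewrite mulr_ge0 ?(quasi_norm_ge0 qN)//=.
    by rewrite bn2 bn ger0_norm ?sqr_ge0// ler_wpM2l ?sqr_ge0.
  exact: cvg_cst.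
have qQ : quadratic Q := D0_quadratic k0 k1 kN1 evQ Q0 DQ.
exists Q; split.
  by move=> x; under eq_fun do rewrite bn2 bn; exact: hQ.
split.
  split=> // x.
  apply: le_trans (rescale_limit_bound p0 BN C0 phi0 step controlF (hQ x)) _.
  by rewrite ler_wpM2r ?powR_ge0// ler_peMl.
move=> Q' [qQ' fQ']; apply/funext => x.
apply: (quasi_cvg_unique qN (hQ x)).
apply: (rescale_cvg_homogeneous p0 BN b0 phi0 controlF x _ _ fQ').
  exact: mulr_ge0 (le_trans ler01 M1) C0.
(* For j = -1 the dilation is by 1 / k: apply homogeneity at y / k. *)
move=> y; rewrite /b; case: hj => ->; last by rewrite expr1z quadraticZ_int.
have /(congr1 (fun v => (k%:~R ^+ 2)^-1 *: v)) := quadraticZ_int k (k%:~R^-1 *: y) qQ'.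
by rewrite !scalerA mulVf ?expf_neq0// mulfV// !scale1r exprN1 exprVn.
Qed.
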